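(* Let $n\ge 1$ be an integer. For every polynomial $P(z)=a_1z+a_2z^2+\cdots+a_nz^n\in\mathfrak{S}_n$ the Jacobian of the moment map is given by $$J_{\mathbb{C}}(P):=\frac{\partial(\bar\mu_{n-1},\ldots,\bar\mu_1,\mu_0,\mu_1,\ldots,\mu_{n-1})}{\partial(\bar a_n,\ldots,\bar a_2,a_1,a_2,\ldots,a_n)}=2\,a_1^{\,n^2-n+1}\,\mathcal{R}(P',P'^* ).$$
   Context: For an integer $n\ge1$, $\mathfrak{S}_n$ denotes the set of polynomials $P(z)=a_1z+a_2z^2+\cdots+a_nz^n$ with complex coefficients, of degree $n$ (so $a_n\neq0$), normalized by $P(0)=0$ and $P'(0)=a_1>0$ (in particular $a_1$ is real). It is identified with the set of coefficient vectors $(a_1,\ldots,a_n)$, an open subset of $\mathbb{R}\times\mathbb{C}^{n-1}$, of real dimension $2n-1$. Complex moments: for $k\ge 0$, $$\mu_k(P)=\frac{i}{2\pi}\iint_{\mathbb{D}}P^k(z)\,|P'(z)|^2\,dz\wedge d\bar z ,$$ where $\mathbb{D}$ is the open unit disk; equivalently $\mu_k(P)=\frac1\pi\iint_{\mathbb D}P^k|P'|^2\,dx\,dy$ with $z=x+iy$. Each $\mu_k(P)$ is a polynomial in $a_1,a_2,\ldots,a_n,\bar a_2,\ldots,\bar a_n$; $\mu_0(P)>0$, and $\mu_k(P)=0$ for $k\ge n$. The moment map is $\mu: P\mapsto(\mu_0(P),\ldots,\mu_{n-1}(P))$, from $\mathfrak{S}_n$ to $\mathbb{R}_+\times\mathbb{C}^{n-1}$.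 $\bar\mu_k$ denotes the complex conjugate of $\mu_k$. The Jacobian $\frac{\partial(\bar\mu_{n-1},\ldots,\bar\mu_1,\mu_0,\ldots,\mu_{n-1})}{\partial(\bar a_n,\ldots,\bar a_2,a_1,\ldots,a_n)}$ is the determinant of the $(2n-1)\times(2n-1)$ matrix of partial derivatives, with functions and variables taken in the displayed orders; the derivatives with respect to $a_j,\bar a_j$ ($j\ge2$) are Wirtinger derivatives (i.e. $a_j$ and $\bar a_j$ are treated as independent variables), and $a_1$ is a real variable. For a polynomial $Q(z)=q_0+q_1z+\cdots+q_mz^m$ of degree $m$, the mirror conjugate image is $Q^*(z):=z^m\bar Q(1/z)=\bar q_m+\bar q_{m-1}z+\cdots+\bar q_0z^m$, where $\bar Q(z)=\overline{Q(\bar z)}$. $P'^*$ means $(P')^*$, with $m=\deg P'=n-1$. The resultant of $A(z)=a_m\prod_{i=1}^m(z-\alpha_i)$ and $B(z)=b_k\prod_{j=1}^k(z-\beta_j)$ (with $a_m,b_k\ne0$) is $\mathcal{R}(A,B)=a_m^k\,b_k^m\prod_{i=1}^{m}\prod_{j=1}^{k}(\alpha_i-\beta_j)$, an empty product being $1$. *)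

(* Defs.v *)
From HB Require Import structures.
From mathcomp Require Import all_boot all_order all_algebra.
From mathcomp Require Import complex.
From mathcomp Require Import all_classical all_reals all_analysis.

Set Implicit Arguments.
Unset Strict Implicit.
Unset Printing Implicit Defensive.

Import Order.TTheory GRing.Theory Num.Theory.
Import numFieldNormedType.Exports.

Local Open Scope classical_set_scope.
Local Open Scope ring_scope.
Local Open Scope complex_scope.

(* In [R[i]], [0 < z] means that [z] is a positive real number. *)
Definition normalized_poly (R : realType) (n : nat) : set {poly R[i]} :=
  [set P | [/\ size P = n.+1, P`_0 = 0 & 0 < P`_1]].

Definition unit_disk (R : realType) : set (R * R) :=
  [set p | `|p.1 +i* p.2| < 1].

Definition complex_integral (R : realType) (D : set (R * R))
    (f : R[i] -> R[i]) : R[i] :=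
  let area := (@lebesgue_measure R \x @lebesgue_measure R)%E in
  (\int[area]_(p in D) complex.Re (f (p.1 +i* p.2))) +i*
  (\int[area]_(p in D) complex.Im (f (p.1 +i* p.2))).

(* The form [i/2 dz /\ d(conj z)] is the area element [dx dy], which turns the
   factor [i/(2 pi)] into [1/pi]. *)
Definition moment (R : realType) (k : nat) (P : {poly R[i]}) : R[i] :=
  (pi^-1)%:C *
  complex_integral (@unit_disk R)
    (fun z => P.[z] ^+ k * `|P^`().[z]| ^+ 2).

Definition real_derive (R : realType) (g : R -> R[i]) (t : R) : R[i] :=
  derive1 (fun s => complex.Re (g s)) t +i*
  derive1 (fun s => complex.Im (g s)) t.

Definition dir_derive (R : realType) (F : {poly R[i]} -> R[i])
    (V P : {poly R[i]}) : R[i] :=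
  real_derive (fun t : R => F (P + t%:C *: V)) 0.

(* With [a_j = x_j + i y_j], moving [x_j] (resp. [y_j]) moves the polynomial
   along ['X^j] (resp. ['i *: 'X^j]). *)
Definition wirtinger (R : realType) (j : nat) (F : {poly R[i]} -> R[i])
    (P : {poly R[i]}) : R[i] :=
  (dir_derive F 'X^j P - 'i%C * dir_derive F ('i%C *: 'X^j) P) / 2.

Definition wirtinger_conj (R : realType) (j : nat) (F : {poly R[i]} -> R[i])
    (P : {poly R[i]}) : R[i] :=
  (dir_derive F 'X^j P + 'i%C * dir_derive F ('i%C *: 'X^j) P) / 2.

(* The [r]-th entry, counted from 0, of
   [conj mu_(n-1), .., conj mu_1, mu_0, mu_1, .., mu_(n-1)]. *)
Definition moment_entry (R : realType) (n r : nat) (P : {poly R[i]}) : R[i] :=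
  if (r < n.-1)%N then (moment (n.-1 - r) P)^* else moment (r - n.-1) P.

(* The partial derivative with respect to the [c]-th entry, counted from 0, of
   [conj a_n, .., conj a_2, a_1, a_2, .., a_n]; [a_1] is a real variable. *)
Definition coef_partial (R : realType) (n c : nat) (F : {poly R[i]} -> R[i])
    (P : {poly R[i]}) : R[i] :=
  if (c < n.-1)%N then wirtinger_conj (n - c) F P
  else if c == n.-1 then dir_derive F 'X P
  else wirtinger (c - n.-1).+1 F P.

Definition jacobian_matrix (R : realType) (n : nat) (P : {poly R[i]}) :
    'M[R[i]]_(n.*2.-1) :=
  \matrix_(r < n.*2.-1, c < n.*2.-1) coef_partial n c (@moment_entry R n r) P.

Definition moment_jacobian (R : realType) (n : nat) (P : {poly R[i]}) : R[i] :=
  \det (jacobian_matrix n P).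

Definition mirror_conj (R : realType) (Q : {poly R[i]}) : {poly R[i]} :=
  \poly_(k < size Q) (Q`_((size Q).-1 - k))^*.

(* The roots of [A] listed with multiplicity. *)
Definition root_seq (R : realType) (A : {poly R[i]}) : seq R[i] :=
  sval (closed_field_poly_normal A).

(* Mathcomp's [resultant A B], the determinant of a Sylvester matrix with
   coefficients in increasing degree, differs from this by the sign
   [(-1) ^+ (deg A * deg B)]. *)
Definition root_resultant (R : realType) (A B : {poly R[i]}) : R[i] :=
  lead_coef A ^+ (size B).-1 * lead_coef B ^+ (size A).-1 *
  \prod_(x <- root_seq A) \prod_(y <- root_seq B) (x - y).

(* Main.v *)
(* Since the integral of z^a conj(z)^b over the disk is pi / (a + 1) if a = b and
   0 otherwise, mu_k(P) = sum_j [P^k P']_j conj(a_(j+1)). Hence a variation V of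
   P moves mu_k by the z^0 coefficient of P^k W, where
   W = conj(z P') V + z P' conj(V) on the circle |z| = 1, and the Jacobian is a
   product of two determinants. The one sending W to the moments is triangular
   with diagonal a_1^|i|, |i| < n, which gives a_1^(n^2 - n). The one sending V
   to z^(n-1) W has the columns z^i P', P'^* + z^(n-1) P', z^i P'^*; it is 2 a_1
   times a Sylvester determinant of P' and P'^*. The Sylvester determinant is
   evaluated by splitting off one root of P' at a time. *)
Require Import Defs.
From mathcomp Require Import all_boot all_order fingroup perm all_algebra.
From mathcomp Require Import complex.
From mathcomp Require Import all_classical all_reals all_analysis.
From mathcomp Require Import measurable_realfun ring lra zify.

Import Order.TTheory GRing.Theory Num.Theory.
Import numFieldNormedType.Exports.

Set Implicit Arguments.
Unset Strict Implicit.
Unset Printing Implicit Defensive.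

Local Open Scope classical_set_scope.
Local Open Scope ring_scope.
Local Open Scope complex_scope.

(** * Determinants of families of polynomials *)

(** The disk integrals are computed in Cartesian coordinates: (1 - |z|^2) z^a conj(z)^b vanishes on
    the circle, so its derivatives in z and conj z integrate to 0. This gives two recurrences
    between the integrals at (a, b) and (a+1, b+1), which disagree unless a = b; only the area pi
    needs an actual integration. Moments and conjugate moments can be read off the same W because
    conjugation on the circle exchanges the W of a_j with that of conj a_j. Columns of matrices are
    kept as polynomials, so that splitting off a root a becomes a change to the basis 1, X - a, X (X
    - a), ... The positivity of a_1 makes a_1 real and gives P'^* the exact degree n - 1. Two signs
    appear, one from listing the coefficients of W in decreasing degree, one from the Sylvester
    determinant, and they cancel. *)

Section Determinants.
Variable K : comNzRingType.
Implicit Types (A B : {poly K}) (Z Y : nat -> {poly K}).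

(* In a term of the Leibniz formula that does not vanish, h increases along every
   moved index, but the sum of h is invariant under the permutation. *)
Lemma det_weighted_trig N (h : 'I_N -> nat) (M : 'M[K]_N) :
  (forall i j, i != j -> (h j <= h i)%N -> M i j = 0) -> \det M = \prod_i M i i.
Proof.
move=> M0; rewrite /determinant (bigD1 (1%g : 'S_N)) //= odd_perm1 expr0 mul1r.
rewrite [X in _ + X]big1 ?addr0; first by apply: eq_bigr => i _; rewrite perm1.
move=> s s1.
suff [i /andP[si hi]] : exists i, (i != s i) && (h (s i) <= h i)%N.
  by rewrite (bigD1 i) //= M0 // mul0r mulr0.
apply/existsP; apply: contraNT s1; rewrite negb_exists => /forallP H.
have hs i : (h i <= h (s i))%N by have := H i; case: eqP => [<-//|_] /=; lia.
have E : \sum_i h (s i) = \sum_i h i by rewrite [RHS](reindex_inj (@perm_inj _ s)).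
apply/eqP/permP => i; rewrite perm1; apply/eqP; rewrite eq_sym; apply: contraT => si.
have := H i; rewrite si /= -ltnNge => hi.
have : (\sum_i h i < \sum_i h (s i))%N.
  by rewrite (bigD1 i) // [ltnRHS](bigD1 i) //= -addSn leq_add // leq_sum.
by rewrite E ltnn.
Qed.

(** The first row has its only 1 in the last column, and the minor left is again antidiagonal. The
    exponent counts the inversions of the reversal. *)
Lemma det_antidiag N :
  \det (\matrix_(i < N, j < N) ((i + j)%N == N.-1)%:R : 'M[K]_N) = (-1) ^+ 'C(N, 2).
Proof.
elim: N => [|N IH]; first by rewrite det_mx00.
rewrite (expand_det_row _ ord0) (bigD1 ord_max) //= big1 ?addr0; last first.
  move=> j jm; rewrite mxE /= add0n; case: eqP => // e; last by rewrite mul0r.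
  by case/eqP: jm; apply: val_inj.
rewrite mxE /= add0n eqxx mul1r /cofactor /= add0n binS bin1 exprD mulrC; congr (_ * _).
rewrite -IH; congr (\det _); apply/matrixP => i j; rewrite !mxE /= /bump leq0n add1n.
by rewrite leqNgt ltn_ord /= add0n; congr (nat_of_bool _)%:R; have := ltn_ord i; lia.
Qed.

Lemma det_rev_rows N (f : nat -> nat -> K) :
  \det (\matrix_(i < N, j < N) f (N.-1 - i)%N j) =
  (-1) ^+ 'C(N, 2) * \det (\matrix_(i < N, j < N) f i j).
Proof.
rewrite -det_antidiag -det_mulmx; congr (\det _); apply/matrixP => i j; rewrite !mxE.
rewrite (bigD1 (rev_ord i)) //= big1 ?addr0; last first.
  move=> k ki; rewrite !mxE; case: eqP => // e; last by rewrite mul0r.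
  by case/eqP: ki; apply: val_inj => /=; have := ltn_ord i; lia.
rewrite !mxE /=; have li := ltn_ord i.
have -> : (i + (N - i.+1) == N.-1)%N by lia.
by rewrite mul1r; congr (f _ _); lia.
Qed.

(** Coefficients of degree at least [N] are cut off, so this is the determinant in the basis 1, X,
    .., X^(N-1) only under size bounds on the columns. *)
Definition pdet N Z : K := \det (\matrix_(i < N, j < N) (Z j)`_i).

Lemma eq_pdet N Z Y : (forall j, (j < N)%N -> Z j = Y j) -> pdet N Z = pdet N Y.
Proof. by move=> e; congr (\det _); apply/matrixP => i j; rewrite !mxE e. Qed.

(** All columns change at once, each by a multiple of its old left neighbour: this is right
    multiplication by a bidiagonal matrix with unit diagonal. Column 0 has no left neighbour, whence
    the condition on [k]. *)
Lemma pdet_col_op N Z (k : nat -> K) : k 0%N = 0 ->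
  pdet N (fun j => Z j - k j *: Z j.-1) = pdet N Z.
Proof.
move=> k0.
pose H : 'M[K]_N := \matrix_(i, j) ((i == j)%:R - k j * (i.+1 == j :> nat)%:R).
have dH : \det H = 1.
  rewrite (@det_weighted_trig _ (@nat_of_ord N)) => [|i j ij ji].
    by rewrite big1 // => i _; rewrite mxE eqxx (gtn_eqF (ltnSn i)) mulr0 subr0.
  by rewrite mxE (negPf ij) gtn_eqF ?ltnS // mulr0 subr0.
rewrite -[RHS]mulr1 -dH -det_mulmx; congr (\det _).
apply/matrixP => i j; rewrite !mxE coefB coefZ.
under eq_bigr => l _ do rewrite !mxE mulrBr.
rewrite sumrB; congr (_ - _).
  rewrite (bigD1 j) //= eqxx mulr1 big1 ?addr0 // => l lj.
  by rewrite (negPf lj) mulr0.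
case: (posnP j) => [j0|j_gt0].
  by rewrite j0 k0 mul0r big1 // => l _; rewrite mul0r mulr0.
have jN : (j.-1 < N)%N by have := ltn_ord j; lia.
rewrite (bigD1 (Ordinal jN)) //= prednK // eqxx mulr1 big1 ?addr0 1?mulrC // => l lj.
case: eqP => [e|_]; last by rewrite !mulr0.
by case/eqP: lj; apply: val_inj => /=; lia.
Qed.

(** In the basis 1, X - a, X (X - a), .. the multiples of X - a have no constant coordinate, so the
    constant row meets only column [q], in the value at [a]. Expanding along it leaves the quotients
    [Y]. *)
Lemma pdet_root N q (a : K) Z Y : (q <= N)%N -> (size (Z q) <= N.+1)%N ->
  (forall j, (j < N)%N -> (size (Y j) <= N)%N) ->
  (forall j, (j < N)%N -> Z (bump q j) = ('X - a%:P) * Y j) ->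
  pdet N.+1 Z = (-1) ^+ q * (Z q).[a] * pdet N Y.
Proof.
move=> qN sZ sY ZY.
have /factor_theorem [W ZW] : root (Z q - (Z q).[a]%:P) a.
  by rewrite /root !hornerE subrr.
(* [E j] lists the coordinates of [Z j] in the basis 1, X - a, X (X - a), .. *)
pose E j := if j == q then W * 'X + (Z q).[a]%:P else Y (unbump q j) * 'X.
have ZE j s : (j < N.+1)%N -> (Z j)`_s = (E j)`_s - a * (E j)`_s.+1.
  move=> jN; rewrite /E; case: (eqVneq j q) => [->|jq].
    rewrite -[Z q in LHS](subrK (Z q).[a]%:P) ZW mulrBr !(coefD, coefN).
    by rewrite !coefMX /= !coefC /= coefMC addr0 addrAC (mulrC a).
  have {1}-> : j = bump q (unbump q j) by rewrite unbumpK // inE.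
  rewrite ZY; last by move: jq jN qN; rewrite /unbump; lia.
  by rewrite mulrBl coefB coefCM (mulrC 'X) !coefMX.
(* No coordinate is lost when the columns [E] are cut at degree [N]. *)
have E0 j : (j < N.+1)%N -> (E j)`_N.+1 = 0.
  move=> jN; rewrite /E; case: (eqVneq j q) => [_|jq].
    have sW : (size W <= N)%N.
      have [->|W0] := eqVneq W 0; first by rewrite size_poly0.
      have sWX : size (W * ('X - a%:P)) = (size W).+1.
        by rewrite size_Mmonic ?monicXsubC // size_XsubC addn2.
      rewrite -ltnS -sWX -ZW (leq_trans (size_polyD _ _)) //.
      by rewrite geq_max sZ size_polyN (leq_trans (size_polyC_leq1 _)).
    by rewrite coefD coefMX coefC /= addr0 nth_default.
  rewrite coefMX /= nth_default // sY //.
  by move: jq jN qN; rewrite /unbump; lia.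
(* Column i of [G] expands the i-th element of the new basis: X^i - a X^(i-1) for i > 0, and 1 for i
   = 0. *)
pose G : 'M[K]_N.+1 := \matrix_(s, i) ((s == i)%:R - a * (s.+1 == i :> nat)%:R).
have dG : \det G = 1.
  rewrite (@det_weighted_trig _ (@nat_of_ord N.+1)) => [|i j ij ji].
    by rewrite big1 // => i _; rewrite mxE eqxx (gtn_eqF (ltnSn i)) mulr0 subr0.
  by rewrite mxE (negPf ij) gtn_eqF ?ltnS // mulr0 subr0.
have -> : pdet N.+1 Z = pdet N.+1 E.
  rewrite -[RHS]mul1r -dG -det_mulmx; congr (\det _).
  apply/matrixP => s j; rewrite !mxE ZE //.
  under eq_bigr => l _ do rewrite !mxE mulrBl.
  rewrite sumrB; congr (_ - _).
    rewrite (bigD1 s) //= eqxx mul1r big1 ?addr0 // => l ls.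
    by rewrite eq_sym (negPf ls) mul0r.
  have [sN|Ns] := ltnP s N; last first.
    rewrite (_ : s.+1 = N.+1); last by have := ltn_ord s; lia.
    rewrite E0 // mulr0 big1 // => l _.
    by rewrite gtn_eqF ?mulr0 ?mul0r.
  rewrite (bigD1 (Ordinal (sN : s.+1 < N.+1)%N)) //= eqxx mulr1 big1 ?addr0 // => l ls.
  case: eqP => [e|_]; last by rewrite mulr0 mul0r.
  by case/eqP: ls; apply: val_inj.
have qN1 : (q < N.+1)%N by [].
rewrite /pdet (expand_det_row _ ord0) (bigD1 (Ordinal qN1)) //= big1 ?addr0; last first.
  move=> j jq; rewrite mxE /E (negPf (jq : _ != q :> nat)) coefMX /= mul0r //.
rewrite mxE /E eqxx coefD coefMX coefC /= add0r /cofactor /= add0n mulrA.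
rewrite (mulrC (Z q).[a]); congr (_ * \det _).
apply/matrixP => i j; rewrite !mxE /= /bump leq0n add1n.
by rewrite -/(bump q j) eq_sym (negPf (neq_bump _ _)) bumpK coefMX /=.
Qed.

Lemma pdet_colD N q (U V : {poly K}) Z : (q < N)%N ->
  pdet N (fun j => if j == q then U + V else Z j) =
  pdet N (fun j => if j == q then U else Z j) +
  pdet N (fun j => if j == q then V else Z j).
Proof.
move=> qN; rewrite /pdet -[LHS]det_tr -[X in _ = X + _]det_tr -[X in _ = _ + X]det_tr.
rewrite (@determinant_multilinear _ _ _
  (\matrix_(i < N, j < N) (if j == q :> nat then U else Z j)`_i)^T
  (\matrix_(i < N, j < N) (if j == q :> nat then V else Z j)`_i)^T (Ordinal qN) 1 1).
- by rewrite !mul1r.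
- by apply/rowP => j; rewrite !mxE /= eqxx !mul1r coefD.
- apply/matrixP => i j; rewrite !mxE.
  by rewrite (_ : (lift _ _ == q :> nat) = false) //; apply/negbTE; rewrite eq_sym neq_bump.
- apply/matrixP => i j; rewrite !mxE.
  by rewrite (_ : (lift _ _ == q :> nat) = false) //; apply/negbTE; rewrite eq_sym neq_bump.
Qed.

(** Here [q] is the degree bound of [B]. Taken with p + q columns, p bounding the degree of [A],
    this is the Sylvester matrix with coefficients in increasing degree. *)
Definition sylvester_cols A B q (j : nat) : {poly K} :=
  if (j < q)%N then 'X^j * A else 'X^(j - q) * B.

Lemma size_XnM A j n : (size A <= n)%N -> (size ('X^j * A)%R <= j + n)%N.
Proof.
move=> /leq_sizeP sA; apply/leq_sizeP => i ji; rewrite coefXnM.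
by case: ltnP => // _; rewrite sA //; lia.
Qed.

Lemma size_sylvester_cols A B p q j : (size A <= p.+1)%N -> (size B <= q.+1)%N ->
  (j < p + q)%N -> (size (sylvester_cols A B q j) <= p + q)%N.
Proof.
move=> sA sB jpq; rewrite /sylvester_cols; case: ltnP => jq.
  by rewrite (leq_trans (size_XnM _ sA)) //; lia.
by rewrite (leq_trans (size_XnM _ sB)) //; lia.
Qed.

(** Subtracting [a] times its left neighbour from each shift of [B] after the first makes every
    column except that first [B] divisible by X - a. The quotients are the Sylvester columns of [A]
    and [B]. *)
Lemma pdet_sylvester_XsubC A B p q (a : K) :
  (size A <= p.+1)%N -> (size B <= q.+1)%N ->
  pdet (p + q).+1 (sylvester_cols (('X - a%:P) * A) B q) =
  (-1) ^+ q * B.[a] * pdet (p + q) (sylvester_cols A B q).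
Proof.
move=> sA sB; rewrite -(@pdet_col_op _ _ (fun j => if (q < j)%N then a else 0)) //.
set Z := fun j => _.
have ZB : Z q = B.
  by rewrite /Z /sylvester_cols ltnn subnn expr0 mul1r scale0r subr0.
rewrite -[X in _ * X.[a]]ZB; apply: pdet_root.
- exact: leq_addl.
- by rewrite ZB (leq_trans sB) // ltnS leq_addl.
- by move=> j jN; exact: size_sylvester_cols.
move=> j jpq; rewrite /Z /bump /sylvester_cols; case: (leqP q j) => qj.
  rewrite add1n ltnS qj /= !ltnNge qj (leqW qj) /= -mul_polyC mulrA -mulrBl mulrA.
  by congr (_ * _); rewrite subSn // exprS mulrBl (mulrC _%:P) (mulrC 'X).
by rewrite add0n qj ltnNge (ltnW qj) /= scale0r subr0 mulrCA.
Qed.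

Lemma pdet_sylvester_prod (c : K) (rs : seq K) B q : (size B <= q.+1)%N ->
  pdet (size rs + q) (sylvester_cols (c *: \prod_(x <- rs) ('X - x%:P)) B q) =
  (-1) ^+ (size rs * q) * c ^+ q * \prod_(x <- rs) B.[x].
Proof.
move=> sB; elim: rs => [|x rs IH].
  rewrite !big_nil add0n mul0n mulr1 mul1r -(det_scalar q c).
  congr (\det _); apply/matrixP => i j; rewrite !mxE /sylvester_cols ltn_ord.
  by rewrite mulrC -scalerAl mul1r coefZ coefXn mulr_natr.
rewrite !big_cons /= scalerAr addSn pdet_sylvester_XsubC ?IH ?mulSn ?exprD //; first by ring.
by rewrite (leq_trans (size_scale_leq _ _)) // size_prod_XsubC.
Qed.

(* For A = P', B = P'^* and m = n - 1, column j is z^m W for the variation of P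
   along the j-th coordinate of (conj a_n, .., conj a_2, a_1, .., a_n). *)
Definition bezout_cols A B m (j : nat) : {poly K} :=
  if (j < m)%N then 'X^j * A else if j == m then B + 'X^m * A else 'X^(j - m) * B.

(** The middle column is split. With X^m A there, every column but the first is divisible by X, and
    the root 0 gives the factor [A]_0[. With B there, only the last column reaches degree 2m, and
    the last row gives the factor]B[_m]. Both minors are the same Sylvester matrix. *)
Lemma pdet_bezout_cols A B m : (size A <= m.+1)%N -> (size B <= m.+1)%N ->
  pdet (m + m).+1 (bezout_cols A B m) =
  (A`_0 + B`_m) * pdet (m + m) (sylvester_cols A B m).
Proof.
move=> sA sB; pose Z := sylvester_cols A B m.
have -> : pdet (m + m).+1 (bezout_cols A B m) =
    pdet (m + m).+1 (fun j => if j == m then B + 'X^m * A else Z j).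
  apply: eq_pdet => j _; rewrite /bezout_cols /Z /sylvester_cols.
  by case: (ltngtP j m).
rewrite pdet_colD; last by rewrite ltnS leq_addr.
rewrite addrC mulrDl; congr (_ + _).
  rewrite (@pdet_root _ 0 0 _ Z) //.
  - rewrite expr0 mul1r -horner_coef0; congr (_.[_] * _).
    case: (posnP m) => [->|m0]; first by rewrite expr0 mul1r.
    by rewrite eq_sym gtn_eqF // /Z /sylvester_cols m0 expr0 mul1r.
  - case: eqP => _; first by rewrite (leq_trans (size_XnM _ sA)) // addnS.
    rewrite /Z /sylvester_cols sub0n expr0 !mul1r; case: ltnP => _.
      by rewrite (leq_trans sA) // ltnS leq_addr.
    by rewrite (leq_trans sB) // ltnS leq_addr.
  - by move=> j jN; exact: size_sylvester_cols.
  - move=> j _; rewrite subr0 /bump leq0n add1n /Z /sylvester_cols.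
    case: (ltngtP j.+1 m) => jm.
    + by rewrite exprS mulrA.
    + by rewrite subSn // exprS mulrA.
    + by rewrite -jm exprS mulrA.
have -> : pdet (m + m).+1 (fun j => if j == m then B else Z j) = pdet (m + m).+1 Z.
  apply: eq_pdet => j _; case: eqP => // ->.
  by rewrite /Z /sylvester_cols ltnn subnn mul1r.
rewrite /pdet (expand_det_row _ ord_max) (bigD1 ord_max) //= big1 ?addr0; last first.
  move=> j jm; rewrite mxE nth_default ?mul0r //= size_sylvester_cols //.
  rewrite ltn_neqAle -ltnS ltn_ord andbT; apply: contraNneq jm => e.
  by apply/eqP/val_inj.
have sgn1 : (-1) ^+ (m + m + (m + m)) = 1 :> K by rewrite addnn -mul2n exprM sqrrN !expr1n.
rewrite mxE /= /cofactor /= sgn1 mul1r.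
congr (_ * _); last congr (determinant _).
  rewrite /Z /sylvester_cols ltnNge leq_addr /= addnK coefXnM ltnNge leq_addr /=.
  by rewrite addnK.
by apply/matrixP => i j; rewrite !mxE !lift_max.
Qed.
End Determinants.

(** * Integration over the unit disk *)

Section Disk.
Variable R : realType.
Local Notation lambda := (@lebesgue_measure R).
Local Notation area := (@lebesgue_measure R \x @lebesgue_measure R)%E.
Local Notation D := (@unit_disk R).

Lemma unit_diskE (p : R * R) : D p <-> p.1 ^+ 2 + p.2 ^+ 2 < 1.
Proof.
rewrite /unit_disk /= -[`|_|]/((Normc.normc (p.1 +i* p.2))%:C) -[X in _ < X]/(1%:C).
rewrite ltcR /= -[X in _ < X]sqrtr1 ltr_sqrt //.
Qed.

Lemma measurable_unit_disk : measurable D.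
Proof.
pose f (p : R * R) := p.1 ^+ 2 + p.2 ^+ 2.
have mf : measurable_fun setT f.
  by apply: measurable_funD; apply: measurable_funX.
have -> : D = f @^-1` [set` `]-oo, 1[].
  by apply/seteqP; split => p /=; rewrite in_itv /= => /unit_diskE.
by rewrite -[X in measurable X]setTI; apply: mf => //.
Qed.

Lemma unit_disk_bound (p : R * R) : D p -> `|p.1| <= 1 /\ `|p.2| <= 1.
Proof.
move=> /unit_diskE h; rewrite !ler_norml; split; apply/andP; split; nra.
Qed.

Lemma area_unit_disk_lty : (area D < +oo)%E.
Proof.
apply: (@le_lt_trans _ _ (area (`[(-1), 1] `*` `[(-1), 1]))).
  apply: le_measure; rewrite ?inE /=.
  - exact: measurable_unit_disk.
  - exact: measurableX.
  - by move=> p /unit_disk_bound /= []; rewrite !ler_norml !in_itv.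
rewrite product_measure1E //= lebesgue_measure_itv /= lte_fin.
by case: ifP => _; rewrite ?mule0 // -EFinD -EFinM ltry.
Qed.

(** A sufficient condition for integrability on the disk that, unlike integrability itself, is
    stable under products. *)
Definition disk_bounded (f : R * R -> R) :=
  measurable_fun setT f /\ exists M, forall p, D p -> `|f p| <= M.

Lemma disk_boundedD f g : disk_bounded f -> disk_bounded g -> disk_bounded (fun p => f p + g p).
Proof.
move=> [mf [M fM]] [mg [K gK]]; split; first exact: measurable_funD.
exists (M + K) => p Dp; rewrite (le_trans (ler_normD _ _))// lerD ?fM ?gK//.
Qed.

Lemma disk_boundedM f g : disk_bounded f -> disk_bounded g -> disk_bounded (fun p => f p * g p).
Proof.
move=> [mf [M fM]] [mg [K gK]]; split; first exact: measurable_funM.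
by exists (M * K) => p Dp; rewrite normrM ler_pM ?fM ?gK.
Qed.

Lemma disk_boundedC c : disk_bounded (fun=> c).
Proof. by split; [exact: measurable_cst | exists `|c|]. Qed.

Lemma disk_bounded_integrable f : disk_bounded f -> area.-integrable D (EFin \o f).
Proof.
move=> [mf [M fM]]; apply: measurable_bounded_integrable => //.
- exact: measurable_unit_disk.
- exact: area_unit_disk_lty.
- exact: measurable_funTS.
- exists M; split; first exact: num_real.
  by move=> x Mx p /fM /le_trans; apply; exact: ltW.
Qed.

Lemma integral_deriv_horner (q : {poly R}) (a b : R) : a < b ->
  (\int[lambda]_(x in `]a, b[) (q^`().[x])%:E = (q.[b] - q.[a])%:E)%E.
Proof.
move=> ab; rewrite -(@integral_itv_bndoo _ _ _ _ true false); last first.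
  apply/measurable_EFinP; apply: measurable_funTS.
  by apply: continuous_measurable_fun; exact: continuous_horner.
rewrite (@continuous_FTC2 _ _ (horner q)) //.
- by apply: continuous_subspaceT; exact: continuous_horner.
- split.
  + by move=> x _; exact: derivable_horner.
  + by apply: cvg_at_right_filter; exact: continuous_horner.
  + by apply: cvg_at_left_filter; exact: continuous_horner.
- by move=> x _; rewrite -derivE.
Qed.

(** For |y| >= 1 the section is empty, and so is the interval, because [Num.sqrt] is 0 at arguments
    that are not positive. *)
Lemma section_diskE (y : R) :
  [set x : R | x ^+ 2 + y ^+ 2 < 1] =
  [set` `]- Num.sqrt (1 - y ^+ 2), Num.sqrt (1 - y ^+ 2)[].
Proof.
apply/seteqP; split => x /=; rewrite in_itv /= -ltr_norml.
  move=> h; rewrite -sqrtr_sqr ltr_sqrt; first lra.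
  by have := sqr_ge0 x; lra.
have [h|h] := ltP 0 (1 - y ^+ 2); last first.
  by rewrite (ler0_sqrtr h) normr_lt0.
by rewrite -sqrtr_sqr ltr_sqrt //; lra.
Qed.

Lemma mem_unit_disk (x y : R) :
  ((x, y) \in D) = (x \in [set x | x ^+ 2 + y ^+ 2 < 1]).
Proof.
apply/idP/idP; rewrite !inE => h; first exact: (iffLR (unit_diskE _) h).
exact: (iffRL (unit_diskE (x, y)) h).
Qed.

Lemma mem_unit_disk_swap (x y : R) : ((x, y) \in D) = ((y, x) \in D).
Proof. by rewrite !mem_unit_disk; apply/idP/idP; rewrite !inE /= addrC. Qed.

(** The ends of the chord lie on the circle, where [q] vanishes. *)
Lemma section_integral_deriv_eq0 (q : {poly R}) (y : R) :
  (forall x, x ^+ 2 + y ^+ 2 = 1 -> q.[x] = 0) ->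
  (\int[lambda]_(x in [set x | (x ^+ 2 + y ^+ 2 < 1)%R]) (q^`().[x])%:E = 0)%E.
Proof.
move=> q0; rewrite section_diskE.
set s := Num.sqrt _.
have [y1|y1] := ltP 0 (1 - y ^+ 2); last first.
  by rewrite /s (ler0_sqrtr y1) oppr0 set_itvoo0 integral_set0.
have s2 : s ^+ 2 = 1 - y ^+ 2 by rewrite sqr_sqrtr // ltW.
have s0 : 0 < s by rewrite sqrtr_gt0.
rewrite integral_deriv_horner; last by rewrite gtrN.
by rewrite !q0 ?subrr // ?sqrrN s2; ring.
Qed.

(** Green's formula without boundary term: by Fubini the integral is taken along horizontal chords
    first, and each chord contributes 0. *)
Lemma disk_integral_dx (f : R * R -> R) (q : R -> {poly R}) :
  disk_bounded f ->
  (forall x y, f (x, y) = (q y)^`().[x]) ->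
  (forall x y, x ^+ 2 + y ^+ 2 = 1 -> (q y).[x] = 0) ->
  \int[area]_(p in D) f p = 0.
Proof.
move=> nf fq q0; rewrite /Rintegral integral_mkcond.
rewrite -integral21_prod_meas1; last first.
  apply/integrable_restrict => //; first exact: measurable_unit_disk.
  by rewrite setTI; exact: disk_bounded_integrable.
rewrite integral0_eq // => y _; rewrite /fubini_G.
rewrite -[RHS](section_integral_deriv_eq0 (q0^~ y)) [RHS]integral_mkcond.
apply: eq_integral => x _; rewrite /patch.
by rewrite mem_unit_disk /= fq.
Qed.

Lemma disk_integral_dy (f : R * R -> R) (q : R -> {poly R}) :
  disk_bounded f ->
  (forall x y, f (x, y) = (q x)^`().[y]) ->
  (forall x y, x ^+ 2 + y ^+ 2 = 1 -> (q x).[y] = 0) ->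
  \int[area]_(p in D) f p = 0.
Proof.
move=> nf fq q0; rewrite /Rintegral integral_mkcond.
rewrite -integral12_prod_meas1; last first.
  apply/integrable_restrict => //; first exact: measurable_unit_disk.
  by rewrite setTI; exact: disk_bounded_integrable.
rewrite integral0_eq // => x _; rewrite /fubini_F.
have q0' y : y ^+ 2 + x ^+ 2 = 1 -> (q x).[y] = 0 by rewrite addrC => /q0.
rewrite -[RHS](section_integral_deriv_eq0 q0') [RHS]integral_mkcond.
apply: eq_integral => y _; rewrite /patch.
by rewrite mem_unit_disk_swap mem_unit_disk /= fq.
Qed.

(** The substitution x = sin t turns the integrand into 2 cos^2 t, with primitive t + sin t cos
    t. *)
Lemma integral_half_disk_height :
  (\int[lambda]_(x in `[(-1)%R, 1%R]) (2 * Num.sqrt (1 - x ^+ 2))%:E = pi%:E)%E.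
Proof.
have pi0 : (0 : R) < pi := pi_gt0 R.
have -> : (-1 : R) = sin (- (pi / 2)) by rewrite sinN sin_pihalf.
rewrite -[X in `[_, X]]sin_pihalf.
have csin : continuous (sin^`()%classic : R -> R).
  have -> : (sin^`()%classic : R -> R) = cos by apply/funext => x; rewrite derive1E derive_val.
  exact: continuous_cos.
rewrite integration_by_substitution_increasing; first last.
- apply: continuous_subspaceT => x; apply: cvgM; first exact: cvg_cst.
  apply: (@continuous_comp _ _ _ (fun x : R => 1 - x ^+ 2) Num.sqrt); last exact: sqrt_continuous.
  by apply: cvgB; [exact: cvg_cst | exact: exprn_continuous].
- split.
  + by move=> x _; exact: derivable_sin.
  + by apply: cvg_at_right_filter; exact: continuous_sin.
  + by apply: cvg_at_left_filter; exact: continuous_sin.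
- by apply: (@cvgP _ _ (sin^`()%classic (pi / 2))); apply: cvg_at_left_filter; exact: csin.
- by apply: (@cvgP _ _ (sin^`()%classic (- (pi / 2)))); apply: cvg_at_right_filter; exact: csin.
- by move=> x _; exact: csin.
- by move=> x y xI yI; rewrite ltr_sin.
- lra.
pose G := fun t : R => t + sin t * cos t.
have dG (t : R) : is_derive t 1 G (2 * cos t ^+ 2).
  rewrite /G; apply: trigger_derive.
  by rewrite /= -![_ *: _]/(_ * _); have := cos2Dsin2 t; nra.
transitivity (\int[lambda]_(x in `[(- (pi / 2))%R, (pi / 2)%R]) (2 * cos x ^+ 2)%:E)%E.
  apply: eq_integral => x; rewrite inE /= in_itv /= => xI; congr EFin.
  rewrite -[LHS]/(2 * Num.sqrt (1 - sin (x : R) ^+ 2) * sin^`()%classic (x : R)).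
  rewrite derive1E derive_val -cos2sin2 sqrtr_sqr ger0_norm; first by rewrite expr2 mulrA.
  exact: cos_ge0_pihalf.
rewrite (@continuous_FTC2 _ _ G).
- by rewrite /G sinN cosN cos_pihalf !mulr0 -EFinD; congr EFin; lra.
- lra.
- apply: continuous_subspaceT => x; apply: cvgM; first exact: cvg_cst.
  apply: (@continuous_comp _ _ _ cos (fun x => x ^+ 2)); last exact: exprn_continuous.
  exact: continuous_cos.
- have cG : continuous G.
    by move=> t; apply/differentiable_continuous/derivable1_diffP; case: (dG t).
  split.
  + by move=> t _; case: (dG t).
  + by apply: cvg_at_right_filter; exact: cG.
  + by apply: cvg_at_left_filter; exact: cG.
- by move=> t _; rewrite derive1E; case: (dG t).
Qed.

Lemma area_unit_disk : \int[area]_(p in D) (1 : R) = pi.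
Proof.
have nf := disk_boundedC 1.
rewrite /Rintegral integral_mkcond.
rewrite -integral12_prod_meas1; last first.
  apply/integrable_restrict => //; first exact: measurable_unit_disk.
  by rewrite setTI; exact: disk_bounded_integrable.
suff -> : (\int[lambda]_x fubini_F lambda (cst 1%:E \_ D) x)%E = pi%:E by [].
rewrite -[RHS]integral_half_disk_height [RHS]integral_mkcond.
apply: eq_integral => x _; rewrite /fubini_F.
transitivity (\int[lambda]_y (cst 1%:E \_ [set y : R | (y ^+ 2 + (x : R) ^+ 2 < 1)%R] y))%E.
  by apply: eq_integral => y _; rewrite /patch mem_unit_disk_swap mem_unit_disk.
rewrite -integral_mkcond section_diskE integral_cst //= lebesgue_measure_itv /=.
rewrite /patch lte_fin mul1e; set s := Num.sqrt _.
have s0 : 0 <= s := sqrtr_ge0 _.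
have [xI|xI] := boolP (_ \in _).
  case: ltP => [_|h]; first by rewrite -EFinD; congr EFin; lra.
  by congr EFin; lra.
suff -> : s = 0 by rewrite oppr0 ltxx.
apply: ler0_sqrtr; move: xI; rewrite notin_setE /= in_itv /=; nra.
Qed.
End Disk.

Local Notation "x ^*" := (conjc x) : ring_scope.

(** * Real and imaginary parts of complex polynomials on the real line *)

Section ReImPoly.
Variable R : realType.
Local Notation C := R[i].
Implicit Types (p : {poly C}) (x y z : C).

Lemma ReD x y : complex.Re (x + y) = complex.Re x + complex.Re y.
Proof. by case: x; case: y. Qed.

Lemma ImD x y : complex.Im (x + y) = complex.Im x + complex.Im y.
Proof. by case: x; case: y. Qed.

Lemma ReM x y : complex.Re (x * y) =
  complex.Re x * complex.Re y - complex.Im x * complex.Im y.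
Proof. by case: x; case: y. Qed.

Lemma ImM x y : complex.Im (x * y) =
  complex.Re x * complex.Im y + complex.Im x * complex.Re y.
Proof. by case: x; case: y. Qed.

Lemma complex_ext x y :
  complex.Re x = complex.Re y -> complex.Im x = complex.Im y -> x = y.
Proof. by case: x => a b; case: y => c d /= -> ->. Qed.

(** At real points, and only there in general, evaluation commutes with taking real parts. Calculus
    on complex polynomials in a real variable thus reduces to [{poly R}]. *)
Definition re_poly p : {poly R} := \poly_(i < size p) complex.Re p`_i.
Definition im_poly p : {poly R} := \poly_(i < size p) complex.Im p`_i.

Lemma coef_re_poly p i : (re_poly p)`_i = complex.Re p`_i.
Proof. by rewrite coef_poly; case: ltnP => // /(nth_default 0) ->. Qed.

Lemma coef_im_poly p i : (im_poly p)`_i = complex.Im p`_i.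
Proof. by rewrite coef_poly; case: ltnP => // /(nth_default 0) ->. Qed.

Lemma horner_re_poly p (t : R) : (re_poly p).[t] = complex.Re p.[t%:C].
Proof.
rewrite horner_poly horner_coef (big_morph (@complex.Re R) ReD erefl).
by apply: eq_bigr => i _; rewrite -rmorphXn ReM /= mulr0 subr0.
Qed.

Lemma horner_im_poly p (t : R) : (im_poly p).[t] = complex.Im p.[t%:C].
Proof.
rewrite horner_poly horner_coef (big_morph (@complex.Im R) ImD erefl).
by apply: eq_bigr => i _; rewrite -rmorphXn ImM /= mulr0 add0r.
Qed.

Lemma ReMn x n : complex.Re (x *+ n) = complex.Re x *+ n.
Proof. by elim: n => // n IH; rewrite !mulrS ReD IH. Qed.

Lemma ImMn x n : complex.Im (x *+ n) = complex.Im x *+ n.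
Proof. by elim: n => // n IH; rewrite !mulrS ImD IH. Qed.

Lemma deriv_re_poly p : (re_poly p)^`() = re_poly p^`().
Proof. by apply/polyP => i; rewrite coef_deriv !coef_re_poly coef_deriv ReMn. Qed.

Lemma deriv_im_poly p : (im_poly p)^`() = im_poly p^`().
Proof. by apply/polyP => i; rewrite coef_deriv !coef_im_poly coef_deriv ImMn. Qed.

Lemma real_derive_horner p (t : R) :
  real_derive (fun s : R => p.[s%:C]) t = p^`().[t%:C].
Proof.
rewrite /real_derive.
rewrite (_ : (fun s => complex.Re _) = horner (re_poly p)); last first.
  by apply/funext => s; rewrite horner_re_poly.
rewrite (_ : (fun s => complex.Im _) = horner (im_poly p)); last first.
  by apply/funext => s; rewrite horner_im_poly.
rewrite -!derivE deriv_re_poly deriv_im_poly horner_re_poly horner_im_poly.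
by case: (_.[_]).
Qed.
End ReImPoly.

(** * Integrals of z^a conj(z)^b over the disk *)

(** [Z] and [W] stand for z and conj z along a line, with slopes [u] and [v]; the differentiated
    polynomial is (1 - ZW) Z^a W^b. The truncated exponents [a.-1] and [b.-1] at 0 carry the
    coefficient 0. *)
Lemma deriv_boundary_poly (K : comNzRingType) (Z W : {poly K}) (u v : K) a b :
  Z^`() = u%:P -> W^`() = v%:P ->
  (Z ^+ a * W ^+ b - Z ^+ a.+1 * W ^+ b.+1)^`() =
  u%:P * (a%:R%:P * (Z ^+ a.-1 * W ^+ b) - a.+1%:R%:P * (Z ^+ a * W ^+ b.+1)) +
  v%:P * (b%:R%:P * (Z ^+ a * W ^+ b.-1) - b.+1%:R%:P * (Z ^+ a.+1 * W ^+ b)).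
Proof.
move=> dZ dW; rewrite derivB !derivM !deriv_exp dZ dW -!(mulr_natl (_ * _)) !succnK !polyC_natr.
move: (a%:R) (b%:R) (a.+1%:R) (b.+1%:R) (u%:P) (v%:P) (Z ^+ a) (W ^+ b).
move: (Z ^+ a.+1) (W ^+ b.+1) (Z ^+ a.-1) (W ^+ b.-1) => *; ring.
Qed.

(** Subtracting the relations gives m = m', and then either one reduces to m = 0. *)
Lemma two_term_recurrences_eq0 (K : idomainType) (x y m m' : K) : x != y ->
  (x + 1) * m = (x + 1 + 1) * m' -> (y + 1) * m = (y + 1 + 1) * m' -> m = 0.
Proof.
move=> xy h1 h2; have mm' : m = m'.
  have : (x - y) * (m - m') = 0.
    transitivity ((x + 1) * m - (x + 1 + 1) * m' - ((y + 1) * m - (y + 1 + 1) * m')).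
      by ring.
    by rewrite h1 h2 !subrr.
  by move/eqP; rewrite mulf_eq0 !subr_eq0 (negPf xy) => /eqP.
have -> : m = (x + 1 + 1) * m - (x + 1) * m by ring.
by rewrite h1 -mm' subrr.
Qed.

Section ComplexDisk.
Variable R : realType.
Local Notation C := R[i].
Local Notation D := (@unit_disk R).
Local Notation I := (complex_integral D).
Implicit Types f g : C -> C.

Definition cdisk_bounded f := disk_bounded (fun p => complex.Re (f (p.1 +i* p.2))) /\
  disk_bounded (fun p => complex.Im (f (p.1 +i* p.2))).

Lemma cdisk_boundedC c : cdisk_bounded (fun=> c).
Proof. by split; exact: disk_boundedC. Qed.

Lemma disk_boundedN (f : R * R -> R) : disk_bounded f -> disk_bounded (fun p => - f p).
Proof.
move=> nf; rewrite (_ : (fun p => _) = fun p => (-1) * f p).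
  by apply: disk_boundedM => //; exact: disk_boundedC.
by apply/funext => p; rewrite mulN1r.
Qed.

Lemma cdisk_boundedD f g : cdisk_bounded f -> cdisk_bounded g ->
  cdisk_bounded (fun z => f z + g z).
Proof.
move=> [rf jf] [rg jg]; split.
- by under [X in disk_bounded X]eq_fun do rewrite ReD; exact: disk_boundedD.
- by under [X in disk_bounded X]eq_fun do rewrite ImD; exact: disk_boundedD.
Qed.

Lemma cdisk_boundedM f g : cdisk_bounded f -> cdisk_bounded g ->
  cdisk_bounded (fun z => f z * g z).
Proof.
move=> [rf jf] [rg jg]; split.
- under [X in disk_bounded X]eq_fun do rewrite ReM.
  by apply: disk_boundedD; [exact: disk_boundedM|apply: disk_boundedN; exact: disk_boundedM].
- under [X in disk_bounded X]eq_fun do rewrite ImM.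
  by apply: disk_boundedD; exact: disk_boundedM.
Qed.

Lemma cdisk_boundedX f n : cdisk_bounded f -> cdisk_bounded (fun z => f z ^+ n).
Proof.
move=> nf; elim: n => [|n IH]; first exact: cdisk_boundedC.
by under [X in cdisk_bounded X]eq_fun do rewrite exprS; exact: cdisk_boundedM.
Qed.

Lemma cdisk_bounded_id : cdisk_bounded id.
Proof.
split; split => /=.
- exact: measurable_fst.
- by exists 1 => p /unit_disk_bound[].
- exact: measurable_snd.
- by exists 1 => p /unit_disk_bound[].
Qed.

Lemma cdisk_bounded_conj : cdisk_bounded (fun z => z^*).
Proof. by have [h1 h2] := cdisk_bounded_id; split => //=; exact: disk_boundedN. Qed.

Lemma cdisk_bounded_sum (J : Type) (r : seq J) (F : J -> C -> C) :
  (forall j, cdisk_bounded (F j)) -> cdisk_bounded (fun z => \sum_(j <- r) F j z).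
Proof.
move=> nF; elim: r => [|j r IH].
  by under [X in cdisk_bounded X]eq_fun do rewrite big_nil; exact: cdisk_boundedC.
by under [X in cdisk_bounded X]eq_fun do rewrite big_cons; exact: cdisk_boundedD.
Qed.

Lemma complex_integralD f g : cdisk_bounded f -> cdisk_bounded g ->
  I (fun z => f z + g z) = I f + I g.
Proof.
move=> [rf jf] [rg jg]; have mD := @measurable_unit_disk R.
apply: complex_ext; rewrite /complex_integral ?ReD ?ImD /=.
- rewrite -RintegralD //; try exact: disk_bounded_integrable.
  by apply: eq_Rintegral => p _; rewrite ReD.
- rewrite -RintegralD //; try exact: disk_bounded_integrable.
  by apply: eq_Rintegral => p _; rewrite ImD.
Qed.

Lemma complex_integralZ c f : cdisk_bounded f -> I (fun z => c * f z) = c * I f.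
Proof.
move=> [rf jf]; have mD := @measurable_unit_disk R.
apply: complex_ext; rewrite /complex_integral ?ReM ?ImM /=.
- rewrite -!RintegralZl //; try exact: disk_bounded_integrable.
  rewrite -RintegralB //; last 2 first.
    by apply: disk_bounded_integrable; apply: disk_boundedM => //; exact: disk_boundedC.
    by apply: disk_bounded_integrable; apply: disk_boundedM => //; exact: disk_boundedC.
  by apply: eq_Rintegral => p _; rewrite ReM.
- rewrite -!RintegralZl //; try exact: disk_bounded_integrable.
  rewrite -RintegralD //; last 2 first.
    by apply: disk_bounded_integrable; apply: disk_boundedM => //; exact: disk_boundedC.
    by apply: disk_bounded_integrable; apply: disk_boundedM => //; exact: disk_boundedC.
  by apply: eq_Rintegral => p _; rewrite ImM.
Qed.

Lemma complex_integral0 : I (fun=> 0) = 0.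
Proof.
rewrite -[RHS](mul0r (I (fun=> 0))) -complex_integralZ; last exact: cdisk_boundedC.
by congr (complex_integral D); apply/funext => z; rewrite mul0r.
Qed.

Lemma complex_integral_sum (J : Type) (r : seq J) (F : J -> C -> C) :
  (forall j, cdisk_bounded (F j)) ->
  I (fun z => \sum_(j <- r) F j z) = \sum_(j <- r) I (F j).
Proof.
move=> nF; elim: r => [|j r IH].
  rewrite big_nil -[RHS]complex_integral0.
  by congr (complex_integral D); apply/funext => z; rewrite big_nil.
rewrite big_cons -IH -complex_integralD //; last exact: cdisk_bounded_sum.
by congr (complex_integral D); apply/funext => z; rewrite big_cons.
Qed.

Lemma complex_integral_dx f (q : R -> {poly C}) : cdisk_bounded f ->
  (forall x y, f (x +i* y) = (q y)^`().[x%:C]) ->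
  (forall x y, x ^+ 2 + y ^+ 2 = 1 -> (q y).[x%:C] = 0) -> I f = 0.
Proof.
move=> [rf jf] fq q0; apply: complex_ext => /=.
- apply: (@disk_integral_dx _ _ (fun y => re_poly (q y))) => //= x y.
    by rewrite deriv_re_poly horner_re_poly fq.
  by rewrite horner_re_poly => /q0 ->.
- apply: (@disk_integral_dx _ _ (fun y => im_poly (q y))) => //= x y.
    by rewrite deriv_im_poly horner_im_poly fq.
  by rewrite horner_im_poly => /q0 ->.
Qed.

Lemma complex_integral_dy f (q : R -> {poly C}) : cdisk_bounded f ->
  (forall x y, f (x +i* y) = (q x)^`().[y%:C]) ->
  (forall x y, x ^+ 2 + y ^+ 2 = 1 -> (q x).[y%:C] = 0) -> I f = 0.
Proof.
move=> [rf jf] fq q0; apply: complex_ext => /=.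
- apply: (@disk_integral_dy _ _ (fun y => re_poly (q y))) => //= x y.
    by rewrite deriv_re_poly horner_re_poly fq.
  by rewrite horner_re_poly => /q0 ->.
- apply: (@disk_integral_dy _ _ (fun y => im_poly (q y))) => //= x y.
    by rewrite deriv_im_poly horner_im_poly fq.
  by rewrite horner_im_poly => /q0 ->.
Qed.

Definition conj_monom (a b : nat) (z : C) : C := z ^+ a * z^* ^+ b.

Lemma cdisk_bounded_conj_monom a b : cdisk_bounded (conj_monom a b).
Proof.
by apply: cdisk_boundedM; apply: cdisk_boundedX; [exact: cdisk_bounded_id|exact: cdisk_bounded_conj].
Qed.

(* [dmonom a b] and [dmonom_conj a b] are the derivatives in z and in conj z of
   (1 - |z|^2) z^a conj(z)^b, which vanishes on the circle. *)
Definition dmonom (a b : nat) (z : C) : C :=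
  a%:R * conj_monom a.-1 b z - a.+1%:R * conj_monom a b.+1 z.

Definition dmonom_conj (a b : nat) (z : C) : C :=
  b%:R * conj_monom a b.-1 z - b.+1%:R * conj_monom a.+1 b z.

Lemma cdisk_bounded_dmonom a b : cdisk_bounded (dmonom a b).
Proof.
apply: cdisk_boundedD.
  by apply: cdisk_boundedM; [exact: cdisk_boundedC|exact: cdisk_bounded_conj_monom].
under [X in cdisk_bounded X]eq_fun do rewrite -mulNr.
by apply: cdisk_boundedM; [exact: cdisk_boundedC|exact: cdisk_bounded_conj_monom].
Qed.

Lemma cdisk_bounded_dmonom_conj a b : cdisk_bounded (dmonom_conj a b).
Proof.
apply: cdisk_boundedD.
  by apply: cdisk_boundedM; [exact: cdisk_boundedC|exact: cdisk_bounded_conj_monom].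
under [X in cdisk_bounded X]eq_fun do rewrite -mulNr.
by apply: cdisk_boundedM; [exact: cdisk_boundedC|exact: cdisk_bounded_conj_monom].
Qed.

Lemma complex_cartesian (x y : R) : x +i* y = x%:C + 'i * y%:C.
Proof. by rewrite [LHS]complexE. Qed.

Lemma conjc_cartesian (x y : R) : (x +i* y)^* = x%:C - 'i * y%:C.
Proof. by rewrite [LHS]complexE /= rmorphN mulrN. Qed.

Lemma conj_monom_circle a b (z : C) : z * z^* = 1 -> conj_monom a.+1 b.+1 z = conj_monom a b z.
Proof.
move=> z1; rewrite /conj_monom !exprS.
rewrite (_ : _ * _ = z * z^* * (z ^+ a * z^* ^+ b)); last by ring.
by rewrite z1 mul1r.
Qed.

Lemma mul_conj_circle (x y : R) : x ^+ 2 + y ^+ 2 = 1 ->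
  (x +i* y) * (x +i* y)^* = 1.
Proof. by move=> h; rewrite -sqr_normc -add_Re2_Im2 /= h. Qed.

(** With f = (1 - |z|^2) z^a conj(z)^b, the derivative of f in x is the sum of its derivatives in z
    and conj z, and the derivative in y is i times their difference. Both have integral 0, and the
    two relations are solved. *)
Lemma complex_integral_dmonom a b :
  I (dmonom a b) = 0 /\ I (dmonom_conj a b) = 0.
Proof.
have n1 := cdisk_bounded_dmonom a b; have n2 := cdisk_bounded_dmonom_conj a b.
have hx : I (dmonom a b) + I (dmonom_conj a b) = 0.
  rewrite -complex_integralD //.
  pose hE := (hornerD, hornerN, hornerM, horner_exp, hornerC, hornerX).
  (* z and conj z as polynomials in x, for fixed y. *)
  pose Z (y : R) : {poly C} := 'X + ('i * y%:C)%:P.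
  pose W (y : R) : {poly C} := 'X - ('i * y%:C)%:P.
  apply: (@complex_integral_dx _
    (fun y => Z y ^+ a * W y ^+ b - Z y ^+ a.+1 * W y ^+ b.+1)).
  - exact: cdisk_boundedD.
  - move=> x y; rewrite (@deriv_boundary_poly _ _ _ 1 1).
    + by rewrite !hE -complex_cartesian -conjc_cartesian ?mul1r.
    + by rewrite derivD derivX derivC addr0.
    + by rewrite derivB derivX derivC subr0.
  - move=> x y h; rewrite !hE -complex_cartesian -conjc_cartesian.
    by have := conj_monom_circle a b (mul_conj_circle h); rewrite /conj_monom => ->; rewrite subrr.
have hy : 'i * I (dmonom a b) + (- 'i) * I (dmonom_conj a b) = 0.
  rewrite -!complex_integralZ // -complex_integralD; first last.
  - by apply: cdisk_boundedM => //; exact: cdisk_boundedC.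
  - by apply: cdisk_boundedM => //; exact: cdisk_boundedC.
  pose hE := (hornerD, hornerN, hornerM, horner_exp, hornerC, hornerX).
  (* z and conj z as polynomials in y, for fixed x. *)
  pose Z (x : R) : {poly C} := x%:C%:P + 'i%:P * 'X.
  pose W (x : R) : {poly C} := x%:C%:P - 'i%:P * 'X.
  apply: (@complex_integral_dy _
    (fun y => Z y ^+ a * W y ^+ b - Z y ^+ a.+1 * W y ^+ b.+1)).
  - by apply: cdisk_boundedD; apply: cdisk_boundedM => //; exact: cdisk_boundedC.
  - move=> x y; rewrite (@deriv_boundary_poly _ _ _ 'i (- 'i)).
    + by rewrite !hE -complex_cartesian -conjc_cartesian ?mul1r.
    + by rewrite derivD derivM derivX !derivC mul0r add0r mulr1 add0r.
    + by rewrite derivB derivM derivX !derivC mul0r !add0r mulr1 polyCN.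
  - move=> x y h; rewrite !hE -complex_cartesian -conjc_cartesian.
    by have := conj_monom_circle a b (mul_conj_circle h); rewrite /conj_monom => ->; rewrite subrr.
have ine : 'i != 0 :> C by rewrite eq_complex /= oner_eq0 andbF.
have e : I (dmonom_conj a b) = - I (dmonom a b) by apply/eqP; rewrite -addr_eq0 addrC hx.
suff e0 : I (dmonom a b) = 0 by rewrite e e0 oppr0.
move: hy; rewrite e mulrNN -mulr2n => /eqP.
by rewrite mulrn_eq0 /= mulf_eq0 (negPf ine) /= => /eqP.
Qed.

Lemma complex_integral_monom_rec a b :
  a.+1%:R * I (conj_monom a b) = a.+2%:R * I (conj_monom a.+1 b.+1) /\
  b.+1%:R * I (conj_monom a b) = b.+2%:R * I (conj_monom a.+1 b.+1).
Proof.
have nm c e k : cdisk_bounded (fun z => k * conj_monom c e z).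
  by apply: cdisk_boundedM; [exact: cdisk_boundedC|exact: cdisk_bounded_conj_monom].
have split c1 c2 a1 b1 a2 b2 :
    I (fun z => c1 * conj_monom a1 b1 z - c2 * conj_monom a2 b2 z) =
    c1 * I (conj_monom a1 b1) - c2 * I (conj_monom a2 b2).
  rewrite -mulNr -!complex_integralZ; try exact: cdisk_bounded_conj_monom.
  rewrite -complex_integralD //.
  by congr (complex_integral D); apply/funext => z; rewrite mulNr.
have [h _] := complex_integral_dmonom a.+1 b.
have [_ h'] := complex_integral_dmonom a b.+1.
by split; apply/eqP; rewrite -subr_eq0 -split; apply/eqP.
Qed.

(** Off the diagonal the two recurrences have different ratios, which forces 0. On it they say that
    (a + 1) times the integral is constant in a, hence equal to the area. *)
Lemma complex_integral_monom a b :
  I (conj_monom a b) = if a == b then pi%:C / a.+1%:R else 0.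
Proof.
have [<-{b}|ab] := eqVneq a b; last first.
  have [h1 h2] := complex_integral_monom_rec a b.
  move: h1 h2; rewrite -![_.+2%:R]natr1 -![_.+1%:R]natr1.
  by apply: two_term_recurrences_eq0; rewrite eqr_nat.
elim: a => [|a IH].
  rewrite divr1 (_ : conj_monom 0 0 = fun=> 1); last first.
    by apply/funext => z; rewrite /conj_monom !expr0 mulr1.
  rewrite /complex_integral /= area_unit_disk /Rintegral integral0_eq //.
have [h _] := complex_integral_monom_rec a a.
have ne : a.+2%:R != 0 :> C by rewrite pnatr_eq0.
apply: (mulfI ne); rewrite -h IH [RHS]mulrC divfK // mulrC divfK //.
Qed.

End ComplexDisk.

(** * Moments and their derivatives *)

Section MomentFormula.
Variable R : realType.
Local Notation C := R[i].
Implicit Types (P Q V f g : {poly C}).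

Lemma conj_horner P (z : C) : (P.[z])^* = (map_poly conjc P).[z^*].
Proof. by rewrite horner_map. Qed.

Lemma size_deriv_leq P K : (size P <= K.+1)%N -> (size P^`() <= K)%N.
Proof.
move=> /leq_sizeP PK; apply/leq_sizeP => j Kj.
by rewrite coef_deriv PK ?mul0rn.
Qed.

(** Orthogonality of the monomials. Only [g] needs a size bound: the higher coefficients of [f] meet
    nothing. *)
Lemma complex_integral_horner f g K : (size g <= K)%N ->
  complex_integral (@unit_disk R) (fun z => f.[z] * (g.[z])^*) =
  pi%:C * \sum_(j < K) f`_j * (g`_j)^* / j.+1%:R.
Proof.
move=> gK.
pose F (ij : 'I_(size f) * 'I_K) (z : C) :=
  (f`_ij.1 * (g`_ij.2)^*) * conj_monom ij.1 ij.2 z.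
have nF ij : cdisk_bounded (F ij).
  by apply: cdisk_boundedM; [exact: cdisk_boundedC|exact: cdisk_bounded_conj_monom].
transitivity (complex_integral (@unit_disk R) (fun z => \sum_ij F ij z)).
  congr (complex_integral _); apply/funext => z.
  rewrite horner_coef (horner_coef_wide _ gK) rmorph_sum /= big_distrlr /=.
  rewrite pair_big; apply: eq_bigr => -[i j] _; rewrite /F /conj_monom rmorphM rmorphXn /=; ring.
rewrite complex_integral_sum // -(pair_bigA _ (fun i j => complex_integral _ (F (i, j)))) /=.
rewrite exchange_big mulr_sumr /=; apply: eq_bigr => j _.
have FE i : complex_integral (@unit_disk R) (F (i, j)) =
    f`_i * (g`_j)^* * (if i == j :> nat then pi%:C / i.+1%:R else 0).
  by rewrite -complex_integral_monom -complex_integralZ //; exact: cdisk_bounded_conj_monom.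
rewrite (eq_bigr _ (fun i _ => FE i)).
have [jf|fj] := ltnP j (size f).
  rewrite (bigD1 (Ordinal jf)) //= eqxx big1 ?addr0; first by ring.
  by move=> i ij; rewrite -val_eqE in ij; rewrite (negPf ij) mulr0.
rewrite (nth_default 0 fj) !mul0r mulr0 big1 // => i _.
by rewrite ltn_eqF ?mulr0 // (leq_trans (ltn_ord i)).
Qed.

(** The integrand is P^k P' times conj P'. The factor j + 1 in the coefficient of P' cancels the 1 /
    (j + 1) of the integral. *)
Lemma momentE k P K : (size P^`() <= K)%N ->
  moment k P = \sum_(j < K) (P ^+ k * P^`())`_j * (P`_j.+1)^*.
Proof.
move=> PK; rewrite /moment.
rewrite (_ : (fun z => _) = fun z => (P ^+ k * P^`()).[z] * (P^`().[z])^*); last first.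
  by apply/funext => z; rewrite sqr_normc hornerM horner_exp mulrA.
rewrite (complex_integral_horner _ PK) mulrA -rmorphM /= mulVf ?mul1r; last first.
  by rewrite gt_eqF // pi_gt0.
apply: eq_bigr => j _; rewrite coef_deriv rmorphMn /= -[_ *+ _]mulr_natr mulrA mulfK //.
Qed.

End MomentFormula.

(** * First-order expansions along a real direction *)

Section Taylor.
Variable R : realType.
Local Notation C := R[i].
Implicit Types (f g : R -> C) (a b c d : C).

(** The polynomial witness keeps differentiation algebraic. As the parameter is real, conjugating
    [f] just conjugates the coefficients of the witness. *)
Definition taylor1 f a b := exists p : {poly C},
  [/\ forall t : R, f t = p.[t%:C], p`_0 = a & p`_1 = b].

Lemma taylor1_derive f a b : taylor1 f a b -> real_derive f 0 = b.
Proof.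
move=> [p [fp _ <-]]; rewrite (_ : f = fun t => p.[t%:C]); last exact/funext.
by rewrite real_derive_horner horner_coef0 coef_deriv.
Qed.

Lemma taylor1_affine a b : taylor1 (fun t => a + t%:C * b) a b.
Proof.
exists (a%:P + b *: 'X); split.
- by move=> t; rewrite !hornerE mulrC.
- by rewrite coefD coefC coefZ coefX mulr0 addr0.
- by rewrite coefD coefC coefZ coefX mulr1 add0r.
Qed.

Lemma taylor1_cst a : taylor1 (fun=> a) a 0.
Proof. by exists a%:P; split=> [t||]; rewrite ?hornerC ?coefC. Qed.

Lemma taylor1D f g a b c d : taylor1 f a b -> taylor1 g c d ->
  taylor1 (fun t => f t + g t) (a + c) (b + d).
Proof.
move=> [p [fp <- <-]] [q [gq <- <-]]; exists (p + q).
by split=> [t||]; rewrite ?hornerD ?coefD ?fp ?gq.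
Qed.

Lemma taylor1M f g a b c d : taylor1 f a b -> taylor1 g c d ->
  taylor1 (fun t => f t * g t) (a * c) (a * d + b * c).
Proof.
move=> [p [fp <- <-]] [q [gq <- <-]]; exists (p * q).
split=> [t||]; first by rewrite hornerM fp gq.
- by rewrite coefM big_ord_recl big_ord0 addr0.
- by rewrite coefM !big_ord_recl big_ord0 addr0.
Qed.

Lemma taylor1_conj f a b : taylor1 f a b -> taylor1 (fun t => (f t)^*) a^* b^*.
Proof.
move=> [p [fp <- <-]]; exists (map_poly conjc p).
by split=> [t||]; rewrite ?coef_map // fp conj_horner conjc_real.
Qed.

Lemma taylor1_sum n (F : 'I_n -> R -> C) (a b : 'I_n -> C) :
  (forall i, taylor1 (F i) (a i) (b i)) ->
  taylor1 (fun t => \sum_i F i t) (\sum_i a i) (\sum_i b i).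
Proof.
elim: n F a b => [|n IH] F a b H.
  by rewrite !big_ord0; under [X in taylor1 X]eq_fun do rewrite big_ord0; exact: taylor1_cst.
rewrite !big_ord_recl; under [X in taylor1 X]eq_fun do rewrite big_ord_recl.
by apply: taylor1D => //; exact: (IH (fun i => F (lift ord0 i))).
Qed.

Definition ptaylor1 (F : R -> {poly C}) (A B : {poly C}) :=
  forall j, taylor1 (fun t => (F t)`_j) A`_j B`_j.

Lemma ptaylor1_affine (A B : {poly C}) : ptaylor1 (fun t => A + t%:C *: B) A B.
Proof.
by move=> j; under [X in taylor1 X]eq_fun do rewrite coefD coefZ; exact: taylor1_affine.
Qed.

Lemma ptaylor1M F G (A B A' B' : {poly C}) : ptaylor1 F A B -> ptaylor1 G A' B' ->
  ptaylor1 (fun t => F t * G t) (A * A') (A * B' + B * A').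
Proof.
move=> hF hG j; rewrite coefD !coefM -big_split /=.
under [X in taylor1 X]eq_fun do rewrite coefM.
by apply: taylor1_sum => i; exact: taylor1M.
Qed.

Lemma ptaylor1_deriv F (A B : {poly C}) : ptaylor1 F A B ->
  ptaylor1 (fun t => (F t)^`()) A^`() B^`().
Proof.
move=> hF j; rewrite !coef_deriv -(mulr_natl A`_j.+1) -(mulr_natl B`_j.+1).
under [X in taylor1 X]eq_fun do rewrite coef_deriv -mulr_natl.
have := taylor1M (taylor1_cst j.+1%:R) (hF j.+1).
by rewrite mul0r addr0.
Qed.

Lemma ptaylor1X F (A B : {poly C}) k : ptaylor1 F A B ->
  ptaylor1 (fun t => F t ^+ k) (A ^+ k) (B * A ^+ k.-1 *+ k).
Proof.
move=> hF; elim: k => [|k IH] /=.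
  rewrite mulr0n expr0 => j; rewrite coef0.
  by under [X in taylor1 X]eq_fun do rewrite expr0; exact: taylor1_cst.
have := ptaylor1M hF IH.
rewrite -exprS (_ : _ + _ = B * A ^+ k *+ k.+1).
  by under eq_fun do rewrite -exprS.
case: k {IH} => [|k]; first by rewrite !mulr0n mulr0 add0r.
by rewrite [RHS]mulrS [LHS]addrC; congr (_ + _); rewrite mulrnAr mulrCA -exprS.
Qed.

(** The slope of P^k P' in direction V is k P^(k-1) V P' + P^k V', that is, (P^k V)'. The value [a]
    is left unspecified since only the slope is used. *)
Lemma moment_taylor1 k (P V : {poly C}) K : (size P <= K.+1)%N -> (size V <= K.+1)%N ->
  exists a, taylor1 (fun t => moment k (P + t%:C *: V)) a
   (\sum_(j < K) ((P ^+ k * V)^`()`_j * (P`_j.+1)^* + (P ^+ k * P^`())`_j * (V`_j.+1)^*)).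
Proof.
move=> sP sV; exists (\sum_(j < K) (P ^+ k * P^`())`_j * (P`_j.+1)^*).
pose F (t : R) := P + t%:C *: V.
rewrite (_ : (fun t => _) =
    fun t => \sum_(j < K) (F t ^+ k * (F t)^`())`_j * ((F t)`_j.+1)^*); last first.
  apply/funext => t; rewrite (@momentE _ _ _ K) // size_deriv_leq //.
  rewrite (leq_trans (size_polyD _ _)) // geq_max sP (leq_trans (size_scale_leq _ _)) //.
apply: taylor1_sum => j.
have hF := ptaylor1_affine P V.
have hp := ptaylor1M (ptaylor1X k hF) (ptaylor1_deriv hF).
have := taylor1M (hp j) (taylor1_conj (hF j.+1)).
congr taylor1; rewrite addrC; congr (_ + _); congr (_ * _); congr (_`_ _).
congr polyseq; rewrite derivM deriv_exp [RHS]addrC !mulrnAl.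
by rewrite (mulrAC V) (mulrC V) mulrAC.
Qed.

Lemma dir_derive_moment k (P V : {poly C}) K : (size P <= K.+1)%N -> (size V <= K.+1)%N ->
  dir_derive (moment k) V P =
   \sum_(j < K) ((P ^+ k * V)^`()`_j * (P`_j.+1)^* + (P ^+ k * P^`())`_j * (V`_j.+1)^*).
Proof. by move=> sP sV; have [a /taylor1_derive] := moment_taylor1 k sP sV. Qed.

Lemma dir_derive_moment_conj k (P V : {poly C}) K : (size P <= K.+1)%N -> (size V <= K.+1)%N ->
  dir_derive (fun P => (moment k P)^*) V P = (dir_derive (moment k) V P)^*.
Proof.
move=> sP sV; rewrite (dir_derive_moment _ sP sV).
by have [a /taylor1_conj /taylor1_derive] := moment_taylor1 k sP sV.
Qed.

End Taylor.

(** * The Jacobian matrix *)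

(** A real-linear form with linear part a and antilinear part b takes the values a + b at 1 and i a
    - i b at i; the Wirtinger combinations recover the two parts. *)
Lemma wirtinger_combination (K : numFieldType) (i a b : K) : i * i = -1 ->
  (a + b - i * (i * a - i * b)) / 2 = a /\ (a + b + i * (i * a - i * b)) / 2 = b.
Proof.
move=> ii; rewrite mulrBr !mulrA ii !mulN1r.
by split; field.
Qed.

Lemma sum_upper_half (K : pzSemiRingType) m (f g : nat -> K) :
  \sum_(s < (m + m).+1) (if (m <= s)%N then f (s - m)%N else 0) * g s =
  \sum_(j < m.+1) f j * g (m + j)%N.
Proof.
rewrite -!(big_mkord xpredT (fun s => (if (m <= s)%N then f (s - m)%N else 0) * g s)).
rewrite (big_cat_nat (n := m)) //=; last by lia.
rewrite big_nat big1 ?add0r => [|s /andP[_ sm]]; last by rewrite leqNgt sm mul0r.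
rewrite -{1}[m]add0n big_addn (_ : (m + m).+1 - m = m.+1)%N; last by lia.
by rewrite big_mkord; apply: eq_bigr => j _; rewrite leq_addl addnK addnC.
Qed.

Lemma sum_lower_half (K : pzSemiRingType) m (f g : nat -> K) :
  \sum_(s < (m + m).+1) (if (s <= m)%N then f (m - s)%N else 0) * g s =
  \sum_(j < m.+1) f j * g (m - j)%N.
Proof.
rewrite (reindex_inj rev_ord_inj) /=.
rewrite [RHS](eq_bigr (fun j : 'I_m.+1 => f j * g ((m + m) - (m + j))%N)); last first.
  by move=> j _; congr (_ * g _); lia.
rewrite -(sum_upper_half m f (fun s => g ((m + m) - s)%N)); apply: eq_bigr => s _.
have ls := ltn_ord s; rewrite subSS (_ : (m + m - s <= m)%N = (m <= s)%N); last by lia.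
by case: ifP => // ms; congr (f _ * _); lia.
Qed.

(** Subtraction being truncated, the summand is |i - m|. With m = n - 1 the total is n^2 - n, the
    exponent of a_1 in the triangular factor. *)
Lemma sum_dist m : (\sum_(i < (m + m).+1) ((i - m) + (m - i)) = m * m.+1)%N.
Proof.
elim: m => [|m IH]; first by rewrite big_ord1.
rewrite addSn addnS big_ord_recl big_ord_recr /=.
under eq_bigr => i _ do rewrite /bump leq0n add1n !subSS.
by rewrite IH /bump leq0n; lia.
Qed.

Lemma coef_exp_lt (K : comNzRingType) (p : {poly K}) k j : p`_0 = 0 -> (j < k)%N -> (p ^+ k)`_j = 0.
Proof.
move=> p0; elim: k j => // k IH j jk; rewrite exprS coefM big_ord_recl p0 mul0r add0r.
rewrite big1 // => i _; rewrite IH ?mulr0 //= /bump leq0n; have := ltn_ord i; lia.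
Qed.

Lemma coef_exp_diag (K : comNzRingType) (p : {poly K}) k : p`_0 = 0 -> (p ^+ k)`_k = p`_1 ^+ k.
Proof.
move=> p0; elim: k => [|k IH]; first by rewrite !expr0 coefC.
rewrite exprS coefM !big_ord_recl p0 mul0r add0r /= subn1 /= IH -exprS.
by rewrite big1 ?addr0 // => i _; rewrite coef_exp_lt ?mulr0 //= /bump; have := ltn_ord i; lia.
Qed.

Section Jacobian.
Variables (R : realType) (m : nat) (P : {poly R[i]}).
Hypothesis sP : size P = m.+2.
Hypothesis P0 : P`_0 = 0.
Hypothesis P1 : 0 < P`_1.
Local Notation C := R[i].
Local Notation Q := P^`().
Local Notation S := (mirror_conj Q).
Local Notation Z := (bezout_cols Q S m).

Lemma size_deriv_normalized : size Q = m.+1.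
Proof.
apply/eqP; rewrite eqn_leq size_deriv_leq ?sP //= ltnNge.
apply/negP => /leq_sizeP /(_ m (leqnn m)) /eqP.
rewrite coef_deriv mulrn_eq0 /= -[m.+1]/(m.+2.-1) -sP -lead_coefE lead_coef_eq0.
by move/eqP => p0; move: sP; rewrite p0 size_poly0.
Qed.

Lemma coef_mirror k : S`_k = if (k <= m)%N then (Q`_(m - k))^* else 0.
Proof. by rewrite coef_poly size_deriv_normalized ltnS. Qed.

Lemma conj_coef1 : (P`_1)^* = P`_1.
Proof. by move: P1; rewrite ltcE; case: (P`_1) => a b /= /andP[/eqP -> _]; rewrite oppr0. Qed.

(** The leading coefficient is the conjugate of P'(0) = a_1, which is not 0. *)
Lemma size_mirror : size S = m.+1.
Proof.
apply/eqP; rewrite eqn_leq; apply/andP; split.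
  by apply/leq_sizeP => j mj; rewrite coef_mirror leqNgt mj.
rewrite ltnNge; apply/negP => /leq_sizeP /(_ m (leqnn m)) /eqP.
by rewrite coef_mirror leqnn subnn coef_deriv mulr1n conj_coef1 gt_eqF.
Qed.

(** Pairing with the conjugate coefficients of P' is taking the z^m coefficient of a product with
    [S], the reversal of those conjugates. In the other term only j = l survives, shifted to degree
    m; it is antilinear in the direction, so i enters as -i. *)
Lemma dir_derive_moment_X k l : (l <= m)%N ->
  dir_derive (moment k) 'X^(l.+1) P =
    (P ^+ k * ('X^l * S))`_m + (P ^+ k * ('X^(m - l) * Q))`_m /\
  dir_derive (moment k) ('i *: 'X^(l.+1)) P =
    'i * (P ^+ k * ('X^l * S))`_m - 'i * (P ^+ k * ('X^(m - l) * Q))`_m.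
Proof.
move=> lm.
have hG : \sum_(j < m.+1) (P ^+ k * 'X^(l.+1))^`()`_j * (P`_j.+1)^* =
    (P ^+ k * ('X^l * S))`_m.
  rewrite mulrA [RHS]coefM; apply: eq_bigr => j _; rewrite coef_mirror leq_subr subKn -1?ltnS //.
  by rewrite !coef_deriv exprSr mulrA coefMX /= rmorphMn /= mulrnAl mulrnAr.
have hH (c : C) : \sum_(j < m.+1) (P ^+ k * Q)`_j * ((c *: 'X^(l.+1))`_j.+1)^* =
    c^* * (P ^+ k * ('X^(m - l) * Q))`_m.
  rewrite mulrCA coefXnM ltnNge leq_subr /= subKn //.
  rewrite (bigD1 (Ordinal (lm : (l < m.+1)%N))) //= big1 ?addr0.
    by rewrite coefZ coefXn eqxx mulr1 mulrC.
  by move=> j jl; rewrite coefZ coefXn eqSS (negPf (jl : (j : nat) != l)) mulr0 conjc0 mulr0.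
have sX : (size ('X^(l.+1) : {poly C})%R <= m.+2)%N by rewrite size_polyXn.
split.
  rewrite (@dir_derive_moment _ _ _ _ m.+1) ?sP // big_split /= hG.
  by have := hH 1; rewrite scale1r conjc1 mul1r => ->.
rewrite (@dir_derive_moment _ _ _ _ m.+1) ?sP //; last first.
  by rewrite (leq_trans (size_scale_leq _ _)).
rewrite big_split /= hH -hG mulr_sumr.
congr (_ + _).
  by apply: eq_bigr => j _; rewrite -scalerAr derivZ coefZ mulrA.
by rewrite (_ : 'i^* = - 'i) ?mulNr //; apply/eqP; rewrite eq_complex /= oppr0 !eqxx.
Qed.

Lemma imaginary_sqr : 'i * 'i = -1 :> C.
Proof. by rewrite -expr2 sqr_i. Qed.

Lemma conj_imaginaryB (a b : C) : ('i * a - 'i * b)^* = 'i * b^* - 'i * a^*.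
Proof. by case: a b => ? ? [? ?]; apply: complex_ext => /=; ring. Qed.

Lemma wirtinger_moment k l : (l <= m)%N ->
  wirtinger l.+1 (moment k) P = (P ^+ k * ('X^l * S))`_m /\
  wirtinger_conj l.+1 (moment k) P = (P ^+ k * ('X^(m - l) * Q))`_m.
Proof.
move=> lm; rewrite /wirtinger /wirtinger_conj; have [-> ->] := dir_derive_moment_X k lm.
exact: wirtinger_combination imaginary_sqr.
Qed.

Lemma wirtinger_moment_conj k l : (l <= m)%N ->
  wirtinger l.+1 (fun P => (moment k P)^*) P = ((P ^+ k * ('X^(m - l) * Q))`_m)^* /\
  wirtinger_conj l.+1 (fun P => (moment k P)^*) P = ((P ^+ k * ('X^l * S))`_m)^*.
Proof.
move=> lm; rewrite /wirtinger /wirtinger_conj.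
rewrite !(@dir_derive_moment_conj _ _ _ _ m.+1) ?sP ?size_polyXn //; last first.
  by rewrite (leq_trans (size_scale_leq _ _)) // size_polyXn.
have [-> ->] := dir_derive_moment_X k lm.
rewrite rmorphD /= conj_imaginaryB [_^* + _^*]addrC.
exact: wirtinger_combination imaginary_sqr.
Qed.

(** Conjugating a function exchanges its derivatives in a_j and conj a_j, which are the columns [c]
    and 2m - c; hence the reflected column in the rows of conjugate moments. *)
Lemma jacobian_entry r c : (c < (m + m).+1)%N ->
  coef_partial m.+1 c (@moment_entry R m.+1 r) P =
  if (r < m)%N then ((P ^+ (m - r) * Z (m + m - c)%N)`_m)^*
  else (P ^+ (r - m) * Z c)`_m.
Proof.
move=> cm; rewrite /coef_partial /=.
have dX k : dir_derive (moment k) 'X P = (P ^+ k * (S + 'X^m * Q))`_m.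
  by have [] := dir_derive_moment_X k (leq0n m); rewrite subn0 expr0 mul1r mulrDr coefD.
have dX' k : dir_derive (fun P => (moment k P)^*) 'X P = ((P ^+ k * (S + 'X^m * Q))`_m)^*.
  by rewrite (@dir_derive_moment_conj _ _ _ _ m.+1) ?sP ?size_polyX ?dX.
have cm1 : (c < m)%N -> (m.+1 - c = (m - c).+1)%N by lia.
have [rm|mr] := ltnP r m.
  have -> : @moment_entry R m.+1 r = (fun P => (moment (m - r) P)^*).
    by apply/funext => p; rewrite /moment_entry /= rm.
  rewrite /bezout_cols; case: (ltngtP c m) => [c_lt|c_gt|->].
  - rewrite cm1 //; have [_ ->] := wirtinger_moment_conj (m - r) (leq_subr c m).
    have -> : (m + m - c < m)%N = false by lia.
    have -> : (m + m - c == m)%N = false by lia.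
    by rewrite (_ : (m + m - c - m = m - c)%N) //; lia.
  - have cl : (c - m <= m)%N by lia.
    have [-> _] := wirtinger_moment_conj (m - r) cl.
    have -> : (m + m - c < m)%N by lia.
    by rewrite (_ : (m - (c - m) = m + m - c)%N) //; lia.
  - by rewrite addnK ltnn eqxx dX'.
have -> : @moment_entry R m.+1 r = moment (r - m).
  by apply/funext => p; rewrite /moment_entry /= ltnNge mr.
rewrite /bezout_cols; case: (ltngtP c m) => [c_lt|c_gt|_].
- rewrite cm1 //; have [_ ->] := wirtinger_moment (r - m) (leq_subr c m).
  by rewrite subKn // ltnW.
- have cl : (c - m <= m)%N by lia.
  by have [-> _] := wirtinger_moment (r - m) cl.
- by rewrite dX.
Qed.

(** Column [c] is z^m W_c, where W_c and W_(2m-c) are conjugate on the circle. There conj z = 1/z,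
    so conjugation reflects coefficients about the middle degree m. *)
Lemma bezout_cols_mirror c j : (c <= m + m)%N -> (j <= m)%N ->
  ((Z (m + m - c)%N)`_(m - j))^* = (Z c)`_(m + j).
Proof.
move=> cm jm.
have Qbig i : (m < i)%N -> Q`_i = 0 by move=> mi; rewrite nth_default // size_deriv_normalized.
rewrite /bezout_cols; case: (ltngtP c m) => [c_lt|c_gt|->].
- have -> : (m + m - c < m)%N = false by lia.
  have -> : (m + m - c == m)%N = false by lia.
  rewrite !coefXnM; have -> : (m + j < c)%N = false by lia.
  rewrite (_ : (m + m - c - m = m - c)%N); last by lia.
  case: ltnP => h; first by rewrite Qbig ?conjc0 //; lia.
  rewrite coef_mirror (_ : (_ <= m)%N); last by lia.
  by rewrite conjcK; congr (_`_ _); lia.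
- have -> : (m + m - c < m)%N by lia.
  rewrite !coefXnM; have -> : (m + j < c - m)%N = false by lia.
  rewrite coef_mirror (_ : (_ <= m)%N = (m + m - c <= m - j)%N); last by lia.
  case: (leqP (m + m - c) (m - j)) => h; last by rewrite conjc0.
  by congr ((_`_ _)^*); lia.
- rewrite addnK ltnn eqxx !coefD !coefXnM !coef_mirror rmorphD /=.
  have -> : (m + j < m)%N = false by lia.
  rewrite leq_subr subKn // conjcK addKn addrC; congr (_ + _).
  case: (posnP j) => [->|j0].
    by rewrite subn0 addn0 ltnn leqnn subnn.
  have -> : (m - j < m)%N by lia.
  by have -> : (m + j <= m)%N = false by [lia]; rewrite conjc0.
Qed.

(* Row r is a moment as a linear form in W: entry s multiplies the coefficient of
   z^(m - s). *)
Definition power_entry (r s : nat) : C :=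
  if (r < m)%N then (if (s <= m)%N then ((P ^+ (m - r))`_(m - s))^* else 0)
  else (if (m <= s)%N then (P ^+ (r - m))`_(s - m) else 0).

(** P^k starts in degree k with a_1^k, so off the diagonal an entry survives only if its column is
    farther from the middle than its row. The matrix is triangular for the distance to the middle,
    not for the usual order. *)
Lemma det_power_entry :
  \det (\matrix_(r < (m + m).+1, s < (m + m).+1) power_entry r s) =
  P`_1 ^+ (m * m.+1).
Proof.
rewrite (@det_weighted_trig _ _ (fun r => (r - m) + (m - r))%N).
  rewrite -sum_dist -prodrXr; apply: eq_bigr => r _; rewrite mxE /power_entry.
  case: ltnP => rm; rewrite coef_exp_diag //.
    by rewrite ltnW // rmorphXn /= conj_coef1; congr (_ ^+ _); lia.
  by congr (_ ^+ _); lia.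
move=> r s; rewrite -val_eqE mxE /power_entry /= => rs hrs.
case: ltnP => rm; case: leqP => sm //; rewrite coef_exp_lt ?conjc0 //; lia.
Qed.

Lemma jacobian_entry_power r c : (r < (m + m).+1)%N -> (c < (m + m).+1)%N ->
  coef_partial m.+1 c (@moment_entry R m.+1 r) P =
  \sum_(s < (m + m).+1) power_entry r s * (Z c)`_((m + m) - s).
Proof.
move=> rN cN; rewrite jacobian_entry // /power_entry; case: ltnP => rm.
  rewrite (sum_lower_half m (fun j => ((P ^+ (m - r))`_j)^*) (fun s => (Z c)`_(m + m - s))).
  rewrite coefM rmorph_sum /=; apply: eq_bigr => j _; rewrite rmorphM /=; congr (_ * _).
  by rewrite bezout_cols_mirror //; [congr (_`_ _)|]; have := ltn_ord j; lia.
rewrite (sum_upper_half m (fun j => (P ^+ (r - m))`_j) (fun s => (Z c)`_(m + m - s))).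
by rewrite coefM; apply: eq_bigr => j _; congr (_ * _`_ _); lia.
Qed.

Lemma moment_jacobianE :
  moment_jacobian m.+1 P = P`_1 ^+ (m * m.+1) *
    ((-1) ^+ 'C((m + m).+1, 2) * ((P`_1 + P`_1) * pdet (m + m) (sylvester_cols Q S m))).
Proof.
have sQ := size_deriv_normalized; have sS := size_mirror.
have -> : P`_1 + P`_1 = Q`_0 + S`_m.
  by rewrite coef_mirror leqnn subnn coef_deriv mulr1n conj_coef1.
(* [power_entry] reads the coefficients of z^m W in decreasing degree, whence the reversal of rows
   and its sign. *)
rewrite -pdet_bezout_cols ?sQ ?sS // -(det_rev_rows _ (fun i j => (Z j)`_i)).
rewrite -det_power_entry -det_mulmx /moment_jacobian /jacobian_matrix.
(* The dimension is abstracted so that it can be rewritten inside the matrix type. *)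
pose J N := \det (\matrix_(r < N, c < N) coef_partial m.+1 c (@moment_entry R m.+1 r) P).
rewrite -[LHS]/(J (m.+1).*2.-1) (_ : (m.+1).*2.-1 = (m + m).+1); last by rewrite -addnn addnS.
congr (\det _); apply/matrixP => r c; rewrite !mxE jacobian_entry_power //.
by apply: eq_bigr => s _; rewrite !mxE.
Qed.

End Jacobian.

(** * The resultant as a product over roots, and the final formula *)

Lemma horner_root_seq (R : realType) (A : {poly R[i]}) (x : R[i]) :
  A.[x] = lead_coef A * \prod_(y <- root_seq A) (x - y).
Proof.
rewrite /root_seq; case: closed_field_poly_normal => rs /= Ars.
rewrite {1}Ars hornerZ horner_prod; congr (_ * _).
by apply: eq_bigr => y _; rewrite hornerXsubC.
Qed.

Lemma root_seqE (R : realType) (A : {poly R[i]}) :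
  A = lead_coef A *: \prod_(x <- root_seq A) ('X - x%:P).
Proof. by rewrite /root_seq; case: closed_field_poly_normal. Qed.

Lemma size_root_seq (R : realType) (A : {poly R[i]}) : A != 0 ->
  size (root_seq A) = (size A).-1.
Proof.
by move=> A0; rewrite {2}(root_seqE A) size_scale ?lead_coef_eq0 // size_prod_XsubC.
Qed.

(** The Sylvester determinant is a product of values of B at the p roots of A; factoring B at each
    root produces the differences of roots and the p-th power of the leading coefficient of B. *)
Lemma pdet_sylvester_resultant (R : realType) (A B : {poly R[i]}) p q :
  size A = p.+1 -> size B = q.+1 ->
  pdet (p + q) (sylvester_cols A B q) = (-1) ^+ (p * q) * root_resultant A B.
Proof.
move=> sA sB; have A0 : A != 0 by rewrite -size_poly_eq0 sA.
have := size_root_seq A0; rewrite sA /= => sr.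
rewrite {1}(root_seqE A) -{1}sr pdet_sylvester_prod ?sB // sr /root_resultant sA sB /= -!mulrA.
congr (_ * (_ * _)).
under eq_bigr => x _ do rewrite (horner_root_seq B).
by rewrite big_split /= big_const_seq count_predT sr iter_mulr_1.
Qed.

Lemma sign_cancel (K : comNzRingType) (s t u v w : K) : s * t = 1 ->
  u * (s * ((v + v) * (t * w))) = 2 * (u * v) * w.
Proof.
by move=> st; transitivity (s * t * (2 * (u * v) * w)); [ring|rewrite st mul1r].
Qed.

Unset Implicit Arguments.

Theorem theorem1 (R : realType) (n : nat) (hn : (1 <= n)%N)
    (P : {poly R[i]}) (hP : normalized_poly n P) :
  moment_jacobian n P =
  2 * P`_1 ^+ (n ^ 2 - n + 1)%N * root_resultant P^`() (mirror_conj P^`()).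
Proof.
case: n hn hP => // m _ [sP P0 P1].
rewrite (moment_jacobianE sP P0 P1).
rewrite (pdet_sylvester_resultant (size_deriv_normalized sP) (size_mirror sP P1)).
(* The exponents are m (2m + 1) and m^2, both of the parity of m. *)
have sgn : (-1) ^+ 'C((m + m).+1, 2) * (-1) ^+ (m * m) = 1 :> R[i].
  rewrite -exprD -signr_odd bin2 /= (_ : odd _ = false) //.
  have -> : ((m + m).+1 * (m + m))./2 = ((m + m).+1 * m)%N.
    by rewrite addnn -doubleMr doubleK.
  by rewrite oddD !oddM /= oddD addbb; case: odd.
(* m (m + 1) powers of a_1 come from the triangular factor and one more from the factor 2 a_1. *)
have -> : (m.+1 ^ 2 - m.+1 + 1 = (m * m.+1).+1)%N by rewrite -mulnn; lia.
rewrite exprSr; move: sgn; exact: sign_cancel.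
Qed.
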